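(* Let $\mathbb{K}$ be a field of characteristic different from $2$ and let $V$ be a $4$-dimensional $\mathbb{K}$-vector space. The set $\mathcal{HL}_4$ of skew-symmetric bilinear maps $\mu:V\times V\to V$ for which $(V,\mu)$ is a Hom-Lie algebra is an algebraic variety embedded in $\mathbb{K}^{24}$; that is, under the identification of skew-symmetric bilinear maps with their structure constants, $\mathcal{HL}_4$ is the set of common zeros in $\mathbb{K}^{24}$ of a family of polynomials with coefficients in $\mathbb{K}$.
   Context: Skew-symmetric bilinear maps $\mu:V\times V\to V$ (i.e. $\mu(X,Y)=-\mu(Y,X)$) form a $24$-dimensional vector space, identified with $\mathbb{K}^{24}$ via the structure constants $C_{i,j}^k$ ($1\le i<j\le 4$, $1\le k\le 4$) in a fixed basis $\{e_1,\dots,e_4\}$, where $\mu(e_i,e_j)=\sum_k C_{i,j}^k e_k$. The algebra $(V,\mu)$ is a Hom-Lie algebra if there is a nonzero linear map $f:V\to V$ with $\mu(\mu(x,y),f(z))+\mu(\mu(y,z),f(x))+\mu(\mu(z,x),f(y))=0$ for all $x,y,z\in V$. *)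

(* Defs.v *)
(* Mathematical Components, with multinomials for {mpoly K[n]}. *)
From HB Require Import structures.
From mathcomp Require Import all_boot all_order all_algebra.
From mathcomp.multinomials Require Import mpoly.
From mathcomp Require Import ring.

Set Implicit Arguments.
Unset Strict Implicit.
Unset Printing Implicit Defensive.

Import GRing.Theory.
Local Open Scope ring_scope.

Definition skew_symmetric (K : fieldType) (V : vectType K) (mu : V -> V -> V) :
    Prop :=
  forall X Y : V, mu X Y = - mu Y X.

Definition hom_jacobi (K : fieldType) (V : vectType K) (mu : V -> V -> V)
    (f : 'End(V)) : Prop :=
  forall x y z : V,
    mu (mu x y) (f z) + mu (mu y z) (f x) + mu (mu z x) (f y) = 0.

Definition hom_lie (K : fieldType) (V : vectType K) (mu : V -> V -> V) : Prop :=
  exists2 f : 'End(V), f != 0 & hom_jacobi mu f.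

Definition HL (K : fieldType) (V : vectType K)
    (mu : {bilinear V -> V -> V}) : Prop :=
  skew_symmetric mu /\ hom_lie mu.

Definition pairs4 : seq (nat * nat) :=
  [:: (0, 1); (0, 2); (0, 3); (1, 2); (1, 3); (2, 3)]%N.

(* Indices are 0-based and the triples (i, j, k) with i < j are ordered
   lexicographically: coordinate 4 p + k is C_{i,j}^k, where (i, j) is the
   p-th element of pairs4. *)
Definition structure_constants (K : fieldType) (V : vectType K)
    (e : 4.-tuple V) (mu : V -> V -> V) : 'rV[K]_24 :=
  \row_(c < 24) let ij := nth (0, 0)%N pairs4 (c %/ 4) in
                coord e (inord (c %% 4)) (mu e`_ij.1 e`_ij.2).

Definition algebraic_variety (K : fieldType) (n : nat)
    (S : 'rV[K]_n -> Prop) : Prop :=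
  exists F : {mpoly K[n]} -> Prop,
    forall x : 'rV[K]_n, S x <-> (forall p, F p -> p.@[x 0] = 0).

Section Identification.
Variables (K : fieldType) (V : vectType K) (e : 4.-tuple V).
Hypothesis basis_e : basis_of {:V} e.

Let co (i : nat) (u : V) : K := coord e (inord i) u.

Let coE (i j : nat) : (i < 4)%N -> (j < 4)%N -> co i e`_j = (i == j)%:R.
Proof.
move=> i4 j4; have := coord_free (inord j) (inord i) (basis_free basis_e).
by rewrite /co -val_eqE /= !inordK // eq_sym.
Qed.

Let constE (mu : V -> V -> V) p k : (p < 6)%N -> (k < 4)%N ->
  co k (mu e`_(nth (0, 0)%N pairs4 p).1 e`_(nth (0, 0)%N pairs4 p).2) =
  structure_constants e mu 0 (inord (p * 4 + k)).
Proof.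
move=> p6 k4; have lt : (p * 4 + k < 24)%N.
  by rewrite -[24%N]/(6 * 4)%N -ltn_divLR // divnMDl // divn_small // addn0.
by rewrite mxE inordK // divnMDl // divn_small // addn0 modnMDl modn_small.
Qed.

Lemma structure_constants_inj (mu nu : {bilinear V -> V -> V}) :
    2%N \notin [pchar K] -> skew_symmetric mu -> skew_symmetric nu ->
  structure_constants e mu = structure_constants e nu -> mu =2 nu.
Proof.
move=> charK smu snu eqC.
have two0 : (2%:R : K) != 0 by move: charK; rewrite inE.
have alt (f : V -> V -> V) u : skew_symmetric f -> f u u = 0.
  move=> /(_ u u)/eqP; rewrite -addr_eq0 -mulr2n -scaler_nat scaler_eq0.
  by rewrite (negPf two0) => /eqP.
have vE u v : (forall k, (k < 4)%N -> co k u = co k v) -> u = v.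
  move=> h; rewrite (coord_basis basis_e (memvf u)) (coord_basis basis_e (memvf v)).
  by apply: eq_bigr => k _; move: (h k (ltn_ord k)); rewrite /co inord_val => ->.
have lt p : (p < 6)%N -> let ij := nth (0, 0)%N pairs4 p in
    mu e`_ij.1 e`_ij.2 = nu e`_ij.1 e`_ij.2.
  by move=> p6 ij; apply: vE => k k4; rewrite !constE // eqC.
have eE (i j : 'I_4) : mu e`_i e`_j = nu e`_i e`_j.
  have ltn (k l : nat) : (k < l < 4)%N -> mu e`_k e`_l = nu e`_k e`_l.
    move: k l => [|[|[|k]]] [|[|[|[|l]]]] // h;
    [exact: (lt 0%N) | exact: (lt 1%N) | exact: (lt 2%N) | exact: (lt 3%N)
    | exact: (lt 4%N) | exact: (lt 5%N) | by rewrite andbF in h].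
  case: (ltngtP i j) => [ij | ji | ->]; last by rewrite !alt.
    by apply: ltn; rewrite ij /=.
  by rewrite smu snu ltn // ji /=.
move=> u v; rewrite (coord_basis basis_e (memvf u)) (coord_basis basis_e (memvf v)).
rewrite !linear_sumlz /=; apply: eq_bigr => i _; rewrite !linearZl_LR /=.
rewrite !linear_sumr; congr (_ *: _); apply: eq_bigr => j _.
by rewrite !linearZr_LR /= eE.
Qed.

Lemma structure_constants_surj (x : 'rV[K]_24) :
  exists2 mu : {bilinear V -> V -> V},
    skew_symmetric mu & structure_constants e mu = x.
Proof.
pose m u v := \sum_(c < 24) (x 0 c *
  (co (nth (0, 0)%N pairs4 (c %/ 4)).1 u * co (nth (0, 0)%N pairs4 (c %/ 4)).2 v
 - co (nth (0, 0)%N pairs4 (c %/ 4)).2 u * co (nth (0, 0)%N pairs4 (c %/ 4)).1 v))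
   *: e`_(c %% 4).
have skm : skew_symmetric m.
  move=> u v; rewrite -sumrN; apply: eq_bigr => c _; rewrite -scaleNr.
  by congr (_ *: _); ring.
have linm u : linear (m u).
  move=> a v w; rewrite scaler_sumr -big_split; apply: eq_bigr => c _ /=.
  rewrite scalerA -scalerDl; congr (_ *: _).
  by rewrite /co !linearP /=; ring.
have bil : bilinear_for *:%R *:%R m.
  split=> // v a u w; by rewrite /= skm linm opprD -scalerN -!(skm _ v).
pose B := bilinear_isBilinear.Build K V V V *:%R *:%R m bil.
pose mu : {bilinear V -> V -> V} := HB.pack m B.
exists mu => //; apply/rowP => c; rewrite mxE /= /m.
rewrite linear_sum (bigD1 c) //=.
have c6 (d : 'I_24) : (d %/ 4 < 6)%N by rewrite ltn_divLR.
have p1 d : ((nth (0, 0)%N pairs4 d).1 < 4)%N by move: d => [|[|[|[|[|[|d]]]]]] /=; rewrite ?nth_nil.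
have p2 d : ((nth (0, 0)%N pairs4 d).2 < 4)%N by move: d => [|[|[|[|[|[|d]]]]]] /=; rewrite ?nth_nil.
have ck (d : nat) : coord e (inord (c %% 4)%N) e`_(d %% 4)%N = (c %% 4 == d %% 4)%N%:R.
  by rewrite -/(co _ _) coE ?ltn_mod.
rewrite linearZ /= ck eqxx mulr1 !coE // !eqxx big1 ?addr0.
  by move: (c %/ 4)%N (c6 c) => [|[|[|[|[|[|//]]]]]] _; rewrite /= ?mulr0 ?mulr1 ?subr0 ?mulr1.
move=> d dc; rewrite linearZ /= ck !coE //.
case: (c %% 4 =P d %% 4)%N => [cd|_]; last by rewrite mulr0.
have : (d %/ 4 != c %/ 4)%N.
  apply: contra dc => /eqP dc; apply/eqP/val_inj.
  by rewrite /= (divn_eq d 4) dc -cd -divn_eq.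
move: (c %/ 4)%N (c6 c) (d %/ 4)%N (c6 d) => [|[|[|[|[|[|//]]]]]] _ [|[|[|[|[|[|//]]]]]] _ //= _;
by rewrite ?(mulr0, mul0r, subr0, mulr1).
Qed.

End Identification.

(* Main.v *)
Require Import Defs.
From mathcomp Require Import all_boot all_order all_algebra.
From mathcomp.multinomials Require Import mpoly.

(** In coordinates, [hom_jacobi mu f] is a homogeneous linear system in the 16
    matrix entries of [f], whose coefficients are polynomials (of degree 2) in
    the structure constants of [mu]. A nonzero solution exists iff the matrix
    of the system has rank less than 16, i.e. iff all its maximal minors
    vanish. *)

Set Implicit Arguments.
Unset Strict Implicit.
Unset Printing Implicit Defensive.

Import GRing.Theory.
Local Open Scope ring_scope.

(** A right inverse of an invertible [colsub g A] yields one of [A]; conversely, full row rank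
    provides [m] independent columns. Letting [g] be any map is harmless: a repeated column makes
    the determinant vanish. *)
Lemma not_row_free_minors (K : fieldType) (m n : nat) (A : 'M[K]_(m, n)) :
  ~~ row_free A <-> forall g : 'I_m -> 'I_n, \det (colsub g A) = 0.
Proof.
split=> [nfA g | minors0].
  apply/eqP; apply: contraNT nfA => detN0.
  have : row_free (colsub g A) by rewrite row_free_unit unitmxE unitfE.
  case/row_freeP => B AB; apply/row_freeP.
  by exists (colsub g 1%:M *m B); rewrite mulmxA mulmx_colsub mulmx1.
apply/negP; rewrite /row_free -mxrank_tr => fA.
have := fullrowsub_unit fA.
by rewrite -trmx_mxsub unitmx_tr unitmxE minors0 unitr0.
Qed.

Lemma row_freePn (K : fieldType) (m n : nat) (A : 'M[K]_(m, n)) :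
  ~~ row_free A <-> exists2 u : 'rV[K]_m, u != 0 & u *m A = 0.
Proof.
split=> [|[u u0 uA]].
  rewrite -kermx_eq0 => /rowV0Pn[u /sub_kermxP uA u0].
  by exists u.
apply: contra u0 => fA; apply/eqP/(row_free_inj fA).
by rewrite uA mul0mx.
Qed.

(** The defining family consists of the maximal minors of the polynomial matrix [M], with unknowns
    as rows and equations as columns. Evaluation at [x] is a ring morphism, so it commutes with
    [\det]. *)
Lemma solvable_algebraic_variety (K : fieldType) (n : nat) (I J : finType)
    (A : I -> J -> {mpoly K[n]}) :
  algebraic_variety (fun x : 'rV[K]_n =>
    exists2 u : I -> K, (exists i, u i != 0) &
      forall j, \sum_i u i * (A i j).@[x 0] = 0).
Proof.
pose M := \matrix_(i < #|I|, j < #|J|) A (enum_val i) (enum_val j).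
exists (fun p => exists g, p = \det (colsub g M)) => x.
have sumE (F : I -> K) : \sum_i F i = \sum_(k < #|I|) F (enum_val k).
  by rewrite (reindex _ (onW_bij _ (@enum_val_bij I))).
have solE : (exists2 u : I -> K, (exists i, u i != 0) &
      forall j, \sum_i u i * (A i j).@[x 0] = 0) <->
    exists2 u : 'rV[K]_#|I|, u != 0 & u *m map_mx (meval (x 0)) M = 0.
  split=> [[u [i ui] uA] | [u u0 uA]].
    exists (\row_i u (enum_val i)).
      by apply/rV0Pn; exists (enum_rank i); rewrite mxE enum_rankK.
    apply/rowP => j; rewrite !mxE -[RHS](uA (enum_val j)).
    by rewrite sumE; apply: eq_bigr => k _; rewrite !mxE.
  exists (fun i => u 0 (enum_rank i)).
    by have /rV0Pn[i ui] := u0; exists (enum_val i); rewrite enum_valK.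
  move=> j; have /rowP/(_ (enum_rank j)) := uA; rewrite !mxE => uAj.
  rewrite -[RHS]uAj sumE; apply: eq_bigr => k _.
  by rewrite !mxE enum_valK enum_rankK.
have minorE g : (\det (colsub g M)).@[x 0] =
    \det (colsub g (map_mx (meval (x 0)) M)).
  by rewrite -det_map_mx; congr (\det _); apply/matrixP => i j; rewrite !mxE.
rewrite solE -row_freePn not_row_free_minors; split=> [M0 p [g ->] | M0 g].
  by rewrite minorE.
by rewrite -minorE; apply: M0; exists g.
Qed.

(** The generic [C_{i,j}^k], extended from [i < j] to all pairs by skew-symmetry. *)
Definition structure_poly (K : fieldType) (i j k : 'I_4) : {mpoly K[24]} :=
  if (i < j)%N then 'X_(inord (index (i : nat, j : nat) pairs4 * 4 + k))
  else if (j < i)%N then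
    - 'X_(inord (index (j : nat, i : nat) pairs4 * 4 + k))
  else 0.

(** The [s]-th coordinate of [mu (mu e_i e_j) e_m], with the inner bracket expanded over the
    [e_r]. *)
Definition jacobi_poly (K : fieldType) (i j m s : 'I_4) : {mpoly K[24]} :=
  \sum_r structure_poly K i j r * structure_poly K r m s.

(* The coefficient of the entry [(k, m)] of [f] in the [s]-th coordinate of the
   Hom-Jacobi identity at [(e_i, e_j, e_l)], where [(k, m) = p] and
   [(i, j, l, s) = q]. *)
Definition hom_jacobi_poly (K : fieldType) (p : 'I_4 * 'I_4)
    (q : 'I_4 * 'I_4 * 'I_4 * 'I_4) : {mpoly K[24]} :=
  let: (k, m) := p in let: (i, j, l, s) := q in
  (k == l)%:R * jacobi_poly K i j m s + (k == i)%:R * jacobi_poly K j l m s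
  + (k == j)%:R * jacobi_poly K l i m s.

Section Coordinates.
Variables (K : fieldType) (V : vectType K) (e : 4.-tuple V).
Hypothesis basis_e : basis_of {:V} e.

Lemma basis_sumE (v : V) : v = \sum_(i < 4) coord e i v *: e`_i.
Proof. exact: coord_basis basis_e (memvf v). Qed.

Lemma coord_inj (u v : V) : (forall k, coord e k u = coord e k v) -> u = v.
Proof.
move=> uv; rewrite (basis_sumE u) (basis_sumE v).
by apply: eq_bigr => k _; rewrite uv.
Qed.

Lemma End_of_matrix (a : 'I_4 -> 'I_4 -> K) :
  exists f : 'End(V), forall k m : 'I_4, coord e m (f e`_k) = a k m.
Proof.
have [f fE] := linear_of_free e [seq \sum_m a k m *: e`_m | k <- enum 'I_4].
have {}fE := fE (basis_free basis_e) _.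
exists (linfun f) => k m; rewrite lfunE /=.
have -> : f e`_k = \sum_l a k l *: e`_l.
  rewrite -(nth_map _ 0) ?size_tuple // fE; last first.
    by rewrite size_map size_enum_ord size_tuple.
  by rewrite (nth_map k) ?size_enum_ord // nth_ord_enum.
by rewrite coord_sum_free // (basis_free basis_e).
Qed.

Section Bilinear.
Variable mu : {bilinear V -> V -> V}.

(** The cyclic sum [J] is invariant under rotation of its arguments, so linearity in the first one
    is enough: after three rotations every argument has been reduced to a basis vector. *)
Lemma hom_jacobi_basis (f : 'End(V)) :
  (forall i j l : 'I_4, mu (mu e`_i e`_j) (f e`_l) + mu (mu e`_j e`_l) (f e`_i)
     + mu (mu e`_l e`_i) (f e`_j) = 0) -> hom_jacobi mu f.
Proof.
pose J x y z := mu (mu x y) (f z) + mu (mu y z) (f x) + mu (mu z x) (f y).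
have JC x y z : J x y z = J y z x by rewrite /J -addrA addrC.
have Jlin y z : (forall i : 'I_4, J e`_i y z = 0) -> forall x, J x y z = 0.
  move=> J0 x; rewrite /J (basis_sumE x) linear_sum (linear_sumr mu).
  rewrite (linear_sumr mu) !linear_sumlz -!big_split big1 // => i _ /=.
  rewrite linearZ !linearZl_LR !(linearZr_LR mu) /= linearZl_LR.
  by rewrite -!scalerDr -/(J _ _ _) J0 scaler0.
move=> J0 x y z; apply: (Jlin) => i; rewrite JC.
by apply: (Jlin) => j; rewrite JC; apply: Jlin => l; rewrite JC; apply: J0.
Qed.

Hypothesis skew_mu : skew_symmetric mu.
Hypothesis charK : 2%N \notin [pchar K].
Let x : 'rV[K]_24 := structure_constants e mu.

(** Skew-symmetry gives twice [mu u u] equal to 0, and 2 is invertible in [K]. This justifies the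
    value 0 of [structure_poly] on the diagonal. *)
Lemma skew_diag u : mu u u = 0.
Proof.
have two0 : (2%:R : K) != 0 by move: charK; rewrite inE.
have /eqP := skew_mu u u; rewrite -addr_eq0 -mulr2n -scaler_nat scaler_eq0.
by rewrite (negPf two0) => /eqP.
Qed.

Lemma meval_structure_poly (i j k : 'I_4) :
  (structure_poly K i j k).@[x 0] = coord e k (mu e`_i e`_j).
Proof.
have lt (i' j' : 'I_4) : (i' < j')%N ->
    x 0 (inord (index (i' : nat, j' : nat) pairs4 * 4 + k)) =
    coord e k (mu e`_i' e`_j').
  move=> lij.
  have pin : (i' : nat, j' : nat) \in pairs4.
    by case: i' j' lij => [[|[|[|[|?]]]] ?] [[|[|[|[|?]]]] ?].
  set p := index _ _.
  have p6 : (p < 6)%N by rewrite -[6%N]/(size pairs4) index_mem.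
  have pk : (p * 4 + k < 24)%N.
    by rewrite -[24%N]/(6 * 4)%N -ltn_divLR // divnMDl // divn_small // addn0.
  (* Quotient and remainder by 4 recover [p] and [k] from the position [p * 4 + k]. *)
  rewrite mxE inordK // divnMDl // divn_small // addn0 modnMDl modn_small //.
  by rewrite nth_index // inord_val.
rewrite /structure_poly; case: ltngtP => [ij|ji|/val_inj->].
- by rewrite mevalXU lt.
- by rewrite mevalN mevalXU lt // [in RHS]skew_mu linearN.
- by rewrite meval0 skew_diag linear0.
Qed.

Lemma meval_jacobi_poly (i j m s : 'I_4) :
  (jacobi_poly K i j m s).@[x 0] = coord e s (mu (mu e`_i e`_j) e`_m).
Proof.
rewrite [mu e`_i e`_j]basis_sumE linear_sumlz linear_sum raddf_sum /=.
apply: eq_bigr => r _.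
by rewrite linearZl_LR linearZ mevalM !meval_structure_poly.
Qed.

Lemma meval_hom_jacobi_poly (f : 'End(V)) (i j l s : 'I_4) :
  \sum_(p : 'I_4 * 'I_4) coord e p.2 (f e`_p.1) *
    (hom_jacobi_poly K p (i, j, l, s)).@[x 0] =
  coord e s (mu (mu e`_i e`_j) (f e`_l) + mu (mu e`_j e`_l) (f e`_i)
             + mu (mu e`_l e`_i) (f e`_j)).
Proof.
(* The factor [k == l'] keeps only the entries of [f e_l']; the three cyclic terms are instances of
   this one formula. *)
have termE (i' j' l' : 'I_4) :
    \sum_(k < 4) \sum_(m < 4) coord e m (f e`_k) *
      ((k == l')%:R * (jacobi_poly K i' j' m s).@[x 0]) =
    coord e s (mu (mu e`_i' e`_j') (f e`_l')).
  rewrite (bigD1 l') //= [X in _ + X]big1 ?addr0; last first.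
    by move=> k /negPf->; rewrite big1 // => m _; rewrite mul0r mulr0.
  rewrite [f e`_l']basis_sumE linear_sumr linear_sum; apply: eq_bigr => m _.
  by rewrite eqxx mul1r linearZr_LR linearZ meval_jacobi_poly -basis_sumE.
rewrite !(linearD (coord e s)) /= -!termE !pair_bigA -!big_split.
apply: eq_bigr => -[k m] _ /=.
by rewrite !mevalD !mevalM -!mulrDr !rmorph_nat.
Qed.

End Bilinear.
End Coordinates.

Theorem proposition19 (K : fieldType) (charK : 2%N \notin [pchar K])
    (V : vectType K) (dimV : \dim {:V} = 4%N)
    (e : 4.-tuple V) (basis_e : basis_of {:V} e) :
  algebraic_variety (fun x : 'rV[K]_24 =>
    exists2 mu : {bilinear V -> V -> V},
      HL mu & structure_constants e mu = x).
Proof.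
have [F FE] := solvable_algebraic_variety (hom_jacobi_poly K).
exists F => x; rewrite -FE.
split=> [[mu [skew_mu [f f0 fJ]] <-] | [a [p ap] aJ]].
  exists (fun p : 'I_4 * 'I_4 => coord e p.2 (f e`_p.1)).
    (* If all entries vanished, [f] would kill the basis, against [f != 0]. *)
    case: (pickP (fun p : 'I_4 * 'I_4 => coord e p.2 (f e`_p.1) != 0)) => [p|h].
      by exists p.
    case/eqP: f0; apply/lfunP => v; rewrite lfunE /= (basis_sumE basis_e v).
    rewrite linear_sum big1 // => k _; rewrite linearZ /=.
    rewrite (_ : f _ = 0) ?scaler0 //; apply: (coord_inj basis_e) => m.
    by have /negbFE/eqP := h (k, m); rewrite linear0.
  by case=> [[[i j] l] s]; rewrite meval_hom_jacobi_poly // fJ linear0.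
(* Conversely, the point [x] determines a skew-symmetric [mu], and the solution [a], read as a
   matrix, determines [f]. *)
have [mu skew_mu muE] := structure_constants_surj basis_e x.
exists mu => //; split=> //.
have [f fE] := End_of_matrix basis_e (fun k m => a (k, m)).
exists f.
  apply: contraNneq ap => f0; case: p => k m.
  by rewrite -fE f0 lfunE linear0.
apply: (hom_jacobi_basis basis_e) => i j l; apply: (coord_inj basis_e) => s.
rewrite -meval_hom_jacobi_poly // linear0 -[RHS](aJ (i, j, l, s)) muE.
by apply: eq_bigr => -[k m] _; rewrite fE.
Qed.
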